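(* There is an algorithm that, given a $2$-uniform hypergraph $\mathcal{H}=(V,E)$ with maximum degree $\Delta$, decides whether the dual hypergraph $\mathcal{H}^d$ is conformal, in time $\mathcal{O}(|E||V|^{2}\Delta^2)$.
   Context: A hypergraph is a pair $\mathcal{H}=(V,E)$ with $V$ a finite nonempty set and $E$ a set of subsets of $V$ (hyperedges) such that every vertex lies in some hyperedge; it is $2$-uniform if every hyperedge has exactly two elements (i.e., it is a simple graph without isolated vertices). $\Delta$ is the maximum number of hyperedges containing a vertex. A transversal is a set of vertices meeting every hyperedge; minimal if no proper subset is a transversal. The dual hypergraph $\mathcal{H}^d$ has vertex set $V$ and hyperedges the minimal transversals of $\mathcal{H}$. A hypergraph is conformal if for every set $U$ of vertices such that every pair of vertices of $U$ lies in a common hyperedge, $U$ is contained in some hyperedge. *)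

(* Defs.v *)
Set Warnings "-notation-overridden".
From mathcomp Require Import all_boot.

Set Implicit Arguments.
Unset Strict Implicit.
Unset Printing Implicit Defensive.

(** * Hypergraphs

    A hypergraph on the vertex set [V] is given by its set of hyperedges
    [E : {set {set V}}]. The requirement that [V] is nonempty and covered is the
    separate predicate [is_hypergraph], because the covering condition can fail
    for the dual of an arbitrary hypergraph (a vertex may lie in no minimal
    transversal when some hyperedge contains another one). *)

Section Hypergraphs.

Variable V : finType.
Implicit Types (E : {set {set V}}) (T U : {set V}).

Definition is_hypergraph E : bool := (0 < #|V|) && (cover E == [set: V]).

Definition uniform (k : nat) E : bool := [forall e in E, #|e| == k].

Definition degree E (v : V) : nat := #|[set e in E | v \in e]|.

Definition max_degree E : nat := \max_(v : V) degree E v.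

Definition transversal E T : bool := [forall e in E, T :&: e != set0].

Definition minimal_transversal E T : bool := minset (transversal E) T.

Definition dual E : {set {set V}} := [set T | minimal_transversal E T].

Definition conformal E : bool :=
  [forall U : {set V},
    [forall u in U, forall v in U, (u != v) ==>
       [exists e in E, (u \in e) && (v \in e)]]
    ==> [exists e in E, U \subset e]].

(** The input word of an algorithm on hypergraphs: the number of vertices, the
    number of hyperedges, then for each hyperedge its size followed by the
    numbers of its vertices. The numbering of the vertices by [0 .. #|V| - 1]
    (the order of [vs]), the order of the hyperedges and the order of the
    vertices inside each hyperedge are arbitrary. *)
Definition encodes E (w : seq nat) : Prop :=
  exists (vs : seq V) (es : seq (seq V)),
    [/\ perm_eq vs (enum V),
        all uniq es,
        perm_eq [seq [set v in e] | e <- es] (enum E)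
      & w = size vs :: size es ::
            flatten [seq size e :: [seq index v vs | v <- e] | e <- es]].

End Hypergraphs.

(** * Unit-cost random access machine

    Structured programs over natural-number variables and one unbounded memory
    with indirect addressing. The only arithmetic operations are addition and
    truncated subtraction: unit-cost multiplication would make the uniform cost
    measure unreasonable. Every constant, variable access, memory access,
    arithmetic operation, assignment and test costs one step. *)

Inductive expr : Type :=
| Const of nat
| Var of nat
| Read of expr
| Add of expr & expr
| Sub of expr & expr.

Inductive prog : Type :=
| Skip
| Assign of nat & expr
| Write of expr & expr
| Seq of prog & prog
| If of expr & prog & prog
| While of expr & prog.

Record state : Type := State { vars : nat -> nat; memory : nat -> nat }.

Definition update (f : nat -> nat) (i x : nat) : nat -> nat :=
  fun j => if j == i then x else f j.

Fixpoint eval (s : state) (a : expr) : nat :=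
  match a with
  | Const n => n
  | Var x => vars s x
  | Read b => memory s (eval s b)
  | Add b c => eval s b + eval s c
  | Sub b c => eval s b - eval s c
  end.

Fixpoint cost (a : expr) : nat :=
  match a with
  | Const _ | Var _ => 1
  | Read b => (cost b).+1
  | Add b c | Sub b c => (cost b + cost c).+1
  end.

(** [exec p s t s']: started in [s], the program [p] halts in [s'] after exactly
    [t] steps. A test succeeds when its value is nonzero. *)
Inductive exec : prog -> state -> nat -> state -> Prop :=
| ExecSkip s :
    exec Skip s 1 s
| ExecAssign s x a :
    exec (Assign x a) s (cost a).+1
         (State (update (vars s) x (eval s a)) (memory s))
| ExecWrite s a b :
    exec (Write a b) s (cost a + cost b).+1
         (State (vars s) (update (memory s) (eval s a) (eval s b)))
| ExecSeq p q s1 s2 s3 t u :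
    exec p s1 t s2 -> exec q s2 u s3 ->
    exec (Seq p q) s1 (t + u) s3
| ExecIfTrue a p q s s' t :
    eval s a != 0 -> exec p s t s' ->
    exec (If a p q) s (cost a + t).+1 s'
| ExecIfFalse a p q s s' t :
    eval s a = 0 -> exec q s t s' ->
    exec (If a p q) s (cost a + t).+1 s'
| ExecWhileTrue a p s1 s2 s3 t u :
    eval s1 a != 0 -> exec p s1 t s2 -> exec (While a p) s2 u s3 ->
    exec (While a p) s1 (cost a + t + u).+1 s3
| ExecWhileFalse a p s :
    eval s a = 0 ->
    exec (While a p) s (cost a).+1 s.

(** The input word occupies the memory cells from address 0 on; all other cells
    and all variables are initially 0. The answer is left in variable 0. *)
Definition initial_state (w : seq nat) : state :=
  State (fun=> 0) (fun i => nth 0 w i).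

Definition output (s : state) : nat := vars s 0.

(** Executions are deterministic, so the running time and the answer of a
    program on an input are well defined. *)
Lemma exec_deterministic p s t1 s1 t2 s2 :
  exec p s t1 s1 -> exec p s t2 s2 -> t1 = t2 /\ s1 = s2.
Proof.
move=> H; elim: H t2 s2 => {p s t1 s1}; intros;
  match goal with H : exec _ _ ?t ?s |- _ = ?t /\ _ = ?s =>
    inversion H; subst; clear H end;
  repeat match goal with
  | Hn : is_true (?x != 0), H0 : ?x = 0 |- _ => by rewrite H0 in Hn
  | IH : (forall t s, exec ?p ?s1 t s -> _), H : exec ?p ?s1 _ _ |- _ =>
      case: (IH _ _ H) => ? ?; subst; clear H
  end; by [].
Qed.

(* Main.v *)
Require Import Defs.
From mathcomp Require Import all_boot zify.

(* Call two vertices "together" if some minimal transversal contains both; for a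
   graph this means that they have neighbours, different from both vertices, that
   are equal or not adjacent. The dual is conformal if and only if every maximal
   clique C of this relation is a minimal transversal. C misses an edge uv if and
   only if it contains some x not together with u and some y not together with v,
   so the first thing to test is whether such u, v, x, y exist with x and y
   together; that takes O(|E||V|^2) steps. If C meets every edge, it is a
   non-minimal transversal if and only if it contains a closed neighbourhood, so
   the second thing to test is whether some closed neighbourhood is a clique. The
   relation itself and the second test need only a loop over pairs of edges, and
   |E|^2 <= |E||V| Delta. *)

Set Implicit Arguments.
Unset Strict Implicit.
Unset Printing Implicit Defensive.

(** * Graphs whose dual hypergraph is conformal *)

Section DuallyConformalGraphs.

Variables (V : finType) (E : {set {set V}}).
Hypotheses (coverE : cover E = [set: V]) (uniformE : uniform 2 E).
Implicit Types (x y u v : V) (T U C : {set V}).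

Definition adjacent x y := [set x; y] \in E.

Definition together x y :=
  [exists x', exists y', [&& adjacent x x', adjacent y y', x' != y, y' != x
                           & ~~ adjacent x' y']].

(** The negation says that the closed neighbourhood of [u] is a clique of [together]; the second
    disjunct treats the pairs that contain [u] itself. *)
Definition closed_nbhd_apart u :=
  [exists x, exists y, [&& adjacent u x, adjacent u y & ~~ together x y]
                       || adjacent u x && ~~ together u x].

(** [x = y] is allowed, since [together] is reflexive. *)
Definition missed_edge :=
  [exists u, exists v, adjacent u v &&
    [exists x, exists y, [&& ~~ together x u, ~~ together y v & together x y]]].

Lemma adjacentC x y : adjacent x y = adjacent y x.
Proof. by rewrite /adjacent setUC. Qed.

Lemma adjacent_irr x : adjacent x x = false.
Proof.
by apply/negP => /(forall_inP uniformE); rewrite setUid cards1.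
Qed.

Lemma adjacentP e : e \in E -> exists x y, adjacent x y /\ e = [set x; y].
Proof.
move=> eE; move/forall_inP: uniformE => /(_ e eE) /cards2P[x [y [_ def_e]]].
by exists x, y; rewrite /adjacent -def_e.
Qed.

Lemma neighbour x : exists y, adjacent x y.
Proof.
have : x \in cover E by rewrite coverE.
case/bigcupP=> e /adjacentP[u [v [uv ->]]]; rewrite !inE.
by case/orP=> /eqP->; [exists v | exists u; rewrite adjacentC].
Qed.

Lemma transversalP T :
  reflect (forall x y, adjacent x y -> x \notin T -> y \in T) (Defs.transversal E T).
Proof.
apply: (iffP forall_inP) => [trT x y xy xT | trT e /adjacentP[x [y [xy ->]]]].
  have /set0Pn[z] := trT _ xy; rewrite !inE => /andP[zT].
  by case/orP=> /eqP def_z; rewrite -def_z ?zT // -def_z zT in xT *.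
apply/set0Pn; have [xT | /(trT _ _ xy) yT] := boolP (x \in T).
  by exists x; rewrite !inE xT eqxx.
by exists y; rewrite !inE yT eqxx orbT.
Qed.

(** If all neighbours of [x] were in [T], then [T :\ x] would still meet every edge, against
    minimality. *)
Lemma private_neighbour T x : T \in dual E -> x \in T ->
  exists2 y, adjacent x y & y \notin T.
Proof.
rewrite inE => /minsetP[/transversalP trT minT] xT.
have [/existsP[y /andP[]] | no_y] := boolP [exists y, adjacent x y && (y \notin T)].
  by exists y.
have trTx : Defs.transversal E (T :\ x).
  apply/transversalP => u v uv; rewrite !inE negb_and negbK.
  have nx y : adjacent x y -> y \in T.
    by move=> xy; apply: contraR no_y => yT; apply/existsP; exists y; rewrite xy.
  case/orP=> [/eqP ux | uT].
    rewrite ux in uv; rewrite nx // andbT.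
    by apply: contraTneq uv => ->; rewrite adjacent_irr.
  rewrite (trT u) // andbT; apply: contraNneq uT => vx.
  by apply: nx; rewrite -vx adjacentC.
by have := minT _ trTx (subD1set _ _) => eqT; rewrite -eqT !inE eqxx in xT.
Qed.

(** A transversal inside [T] misses the private neighbour [y] of [x], so it has to contain [x]. *)
Lemma private_edgesP T : Defs.transversal E T ->
  (forall x, x \in T -> exists2 y, adjacent x y & y \notin T) -> T \in dual E.
Proof.
move=> trT priv; rewrite inE; apply/minsetP; split=> // S /transversalP trS sST.
apply/eqP; rewrite eqEsubset sST; apply/subsetP => x /priv[y xy yT].
apply: (trS y); first by rewrite adjacentC.
by apply: contra yT => /(subsetP sST).
Qed.

(** As [x'] and [y'] are not adjacent, the complement of [[set x'; y']] is a transversal; a minimal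
    one inside it avoids [x'] and [y'], hence contains their neighbours [x] and [y]. Conversely,
    private neighbours of [x] and [y] lie outside a transversal, so they are not adjacent. *)
Lemma togetherP x y :
  reflect (exists2 T, T \in dual E & (x \in T) && (y \in T)) (together x y).
Proof.
apply: (iffP existsP) => [[x' /existsP[y']] | [T TE /andP[xT yT]]].
  case/and5P=> xx' yy' x'y y'x x'y'.
  have trC : Defs.transversal E (~: [set x'; y']).
    apply/transversalP => u v uv; rewrite !inE negbK negb_or.
    case/orP=> /eqP def_u; rewrite {}def_u in uv.
      by apply/andP; split; apply: contraTneq uv => ->; rewrite ?adjacent_irr.
    apply/andP; split; apply: contraTneq uv => ->; rewrite ?adjacent_irr //.
    by rewrite adjacentC.
  have [T minT sT] := minset_exists trC.
  have [/transversalP trT _] := minsetP minT.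
  have notT z : z \in [set x'; y'] -> z \notin T.
    by move=> zxy; apply: contraL zxy => /(subsetP sT); rewrite inE.
  exists T; first by rewrite inE.
  rewrite adjacentC in xx'; rewrite adjacentC in yy'.
  rewrite (trT _ _ xx') ?(trT _ _ yy') ?notT //.
    by rewrite !inE eqxx orbT.
  by rewrite !inE eqxx.
have [x' xx' x'T] := private_neighbour TE xT.
have [y' yy' y'T] := private_neighbour TE yT.
exists x'; apply/existsP; exists y'; rewrite xx' yy' /=; apply/and3P; split.
- by apply: contraNneq x'T => ->.
- by apply: contraNneq y'T => ->.
move: TE; rewrite inE => /minsetP[/transversalP trT _].
by apply: contra y'T => /trT; apply.
Qed.

Lemma together_refl x : together x x.
Proof.
have [y xy] := neighbour x; apply/existsP; exists y; apply/existsP; exists y.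
have yx : y != x by apply: contraTneq xy => ->; rewrite adjacent_irr.
by rewrite xy yx adjacent_irr.
Qed.

Lemma togetherC x y : together x y = together y x.
Proof. by apply/togetherP/togetherP => -[T TE]; rewrite andbC; exists T. Qed.

Definition clique C := [forall x in C, forall y in C, together x y].

Lemma cliqueP C :
  reflect {in C &, forall x y, together x y} (clique C).
Proof.
apply: (iffP forall_inP) => [clC x y xC yC | clC x xC].
  by have /forall_inP := clC x xC; apply.
by apply/forall_inP => y; apply: clC.
Qed.

Lemma dual_clique T : T \in dual E -> clique T.
Proof.
by move=> TE; apply/cliqueP => x y xT yT; apply/togetherP; exists T; rewrite ?xT.
Qed.

(** By [togetherP] the pairs covered by hyperedges of the dual are the [together] pairs. The
    diagonal, which [clique] includes and [conformal] leaves out, comes from [together_refl]. *)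
Lemma conformalP :
  reflect (forall C, clique C -> exists2 T, T \in dual E & C \subset T)
          (conformal (dual E)).
Proof.
apply: (iffP forallP) => [confE C /cliqueP clC | confE C].
  have /implyP conf_C := confE C.
  have /existsP[T /andP[TE sCT]] : [exists T in dual E, C \subset T].
    apply: conf_C; apply/forall_inP => x xC; apply/forall_inP => y yC.
    apply/implyP => _; have /togetherP[T TE xyT] := clC _ _ xC yC.
    by apply/existsP; exists T; rewrite TE.
  by exists T.
apply/implyP => /forall_inP pairC; apply/existsP.
have [|T TE sCT] := confE C; last by exists T; rewrite TE.
apply/cliqueP => x y xC yC.
have [-> | xy] := eqVneq x y; first exact: together_refl.
have /existsP[T /andP[TE xyT]] := implyP (forall_inP (pairC x xC) y yC) xy.
by apply/togetherP; exists T.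
Qed.

(** Otherwise [x |: C] would be a larger clique. *)
Lemma maxclique_together C x :
  maxset clique C -> x \notin C -> exists2 y, y \in C & ~~ together y x.
Proof.
move=> /maxsetP[/cliqueP clC maxC] xC.
have [/existsP[y /andP[]] | no_y] :=
  boolP [exists y, (y \in C) && ~~ together y x]; first by exists y.
have togx y : y \in C -> together y x.
  by move=> yC; apply: contraR no_y => yx; apply/existsP; exists y; rewrite yC.
have clCx : clique (x |: C).
  apply/cliqueP => y z; rewrite !inE.
  case/predU1P=> [->|yC] /predU1P[->|zC]; rewrite ?together_refl ?togx //.
    by rewrite togetherC togx.
  exact: clC.
by rewrite -(maxC _ clCx (subsetUr _ _)) !inE eqxx in xC.
Qed.

(* A maximal clique of [together] fails to be a transversal exactly when it
   avoids both ends of an edge, and fails to be a minimal one exactly when it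
   contains the closed neighbourhood of one of its vertices. *)
Lemma conformal_dualE :
  conformal (dual E) = ~~ missed_edge && [forall u, closed_nbhd_apart u].
Proof.
apply/conformalP/andP => [confE | [no_missed /forallP apart] U clU].
  split; last first.
    apply/forallP => u; apply: contraT => not_apart.
    (* A minimal transversal that contains the closed neighbourhood of [u] leaves [u] without a
       private neighbour. *)
    pose N := u |: [set x | adjacent u x].
    have [|T TE sNT] := confE N.
      apply: contraR not_apart => /forall_inPn[x xN /forall_inPn[y yN xy]].
      rewrite /closed_nbhd_apart; move: xN yN xy; rewrite !inE.
      case/predU1P=> [->|ux] /predU1P[->|uy]; rewrite ?together_refl // => xy.
      - by apply/existsP; exists y; apply/existsP; exists y; rewrite uy xy orbT.
      - by apply/existsP; exists x; apply/existsP; exists x;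
          rewrite ux togetherC xy orbT.
      - by apply/existsP; exists x; apply/existsP; exists y; rewrite ux uy xy.
    have [|x ux] := private_neighbour TE (x := u).
      by apply: (subsetP sNT); rewrite !inE eqxx.
    by case/negP; apply: (subsetP sNT); rewrite !inE ux orbT.
  apply/negP => /existsP[u /existsP[v /andP[uv]]].
  case/existsP=> x /existsP[y /and3P[xu yv xy]].
  (* A maximal clique [C] around [x] and [y] is a minimal transversal by conformality. It avoids [u]
     because of [x], so it contains [v], against the choice of [y]. *)
  have clxy : clique [set x; y].
    apply/cliqueP => a b; rewrite !inE.
    by case/orP=> /eqP-> /orP[]/eqP->; rewrite ?together_refl // togetherC.
  have [C maxC /subsetP sC] := maxset_exists clxy.
  have [/confE[T TE sCT] maxC'] := maxsetP maxC.
  have defT := maxC' _ (dual_clique TE) sCT; rewrite {T}defT in TE sCT *.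
  have /cliqueP clC := dual_clique TE.
  move: TE; rewrite inE => /minsetP[/transversalP trC _].
  have xC : x \in C by apply: sC; rewrite !inE eqxx.
  have yC : y \in C by apply: sC; rewrite !inE eqxx orbT.
  have uC : u \notin C by apply: contra xu; apply: clC.
  by have := clC _ _ yC (trC _ _ uv uC); apply/negP.
have [C maxC sUC] := maxset_exists clU; exists C => //.
have [/cliqueP clC _] := maxsetP maxC.
apply: private_edgesP => [|u uC].
  apply/transversalP => u v uv uC; apply: contraR no_missed => vC.
  have [x xC xu] := maxclique_together maxC uC.
  have [y yC yv] := maxclique_together maxC vC.
  apply/existsP; exists u; apply/existsP; exists v; rewrite uv /=.
  by apply/existsP; exists x; apply/existsP; exists y; rewrite xu yv clC.
(* Of two vertices that are not together, at least one is outside the clique [C]; as [u] is in [C],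
   it is a neighbour of [u]. *)
have [x [ux xC]] : exists x, adjacent u x /\ x \notin C.
  case/existsP: (apart u) => x /existsP[y]; case/orP=> [/and3P[ux uy xy]|].
    have [xC | xC] := boolP (x \in C); last by exists x.
    by exists y; split=> //; apply: contra xy; apply: clC.
  by case/andP=> ux nux; exists x; split=> //; apply: contra nux; apply: clC.
by exists x.
Qed.

(** Edges are nonempty, so [E] is the union of the sets of edges at the single vertices. *)
Lemma card_edges : #|E| <= #|V| * max_degree E.
Proof.
have -> : #|E| = #|\bigcup_v [set e in E | v \in e]|.
  congr #|pred_of_set _|; apply/setP=> e; apply/idP/bigcupP => [eE|[v _]].
    have [x [y [_ def_e]]] := adjacentP eE.
    by exists x => //; rewrite inE eE def_e !inE eqxx.
  by rewrite inE => /andP[].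
apply: leq_trans (_ : \sum_v degree E v <= _).
  elim/big_rec2: _ => [|v S m _ le_mS]; first by rewrite cards0.
  by apply: leq_trans (leq_card_setU _ _) _; rewrite leq_add2l.
rewrite -sum_nat_const; apply: leq_sum => v _; exact: leq_bigmax.
Qed.

End DuallyConformalGraphs.

(** * Total-correctness triples with time bounds *)

Definition runs p s T (Q : state -> Prop) :=
  exists t s', [/\ exec p s t s', t <= T & Q s'].

Fixpoint assigned p : seq nat :=
  match p with
  | Skip | Write _ _ => [::]
  | Assign x _ => [:: x]
  | Seq p q | If _ p q => assigned p ++ assigned q
  | While _ p => assigned p
  end.

Lemma exec_frame p s t s' x :
  exec p s t s' -> x \notin assigned p -> vars s' x = vars s x.
Proof.
elim=> {p s t s'} //=.
- by move=> s y a; rewrite inE /update => /negPf->.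
- by move=> p q ? s2 s3 ? ? _ IHp _ IHq; rewrite mem_cat negb_or => /andP[/IHp<- /IHq].
- by move=> a p q ? ? ? _ _ IHp; rewrite mem_cat negb_or => /andP[/IHp].
- by move=> a p q ? ? ? _ _ IHq; rewrite mem_cat negb_or => /andP[_ /IHq].
- by move=> a p ? ? ? ? ? _ _ IHp _ IHw xp; rewrite IHw ?IHp.
Qed.

Lemma runs_weaken p s T T' (Q Q' : state -> Prop) :
  T <= T' -> (forall s', Q s' -> Q' s') -> runs p s T Q -> runs p s T' Q'.
Proof.
move=> leT sQ [t [s' [ex let_ Qs']]]; exists t, s'; split=> //.
  exact: leq_trans leT.
exact: sQ.
Qed.

Lemma runs_assign s x a (Q : state -> Prop) :
  Q (State (update (vars s) x (eval s a)) (memory s)) ->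
  runs (Assign x a) s (cost a).+1 Q.
Proof. by move=> Qs; do 2!eexists; split; [apply: ExecAssign | |]. Qed.

Lemma runs_write s a b (Q : state -> Prop) :
  Q (State (vars s) (update (memory s) (eval s a) (eval s b))) ->
  runs (Write a b) s (cost a + cost b).+1 Q.
Proof. by move=> Qs; do 2!eexists; split; [apply: ExecWrite | |]. Qed.

Lemma runs_seq p q s T1 T2 (Q R : state -> Prop) :
  runs p s T1 Q -> (forall s', Q s' -> runs q s' T2 R) ->
  runs (Seq p q) s (T1 + T2) R.
Proof.
move=> [t [s' [exp let_ Qs]]] /(_ s' Qs)[u [s2 [exq leu Rs]]].
exists (t + u), s2; split=> //; last exact: leq_add.
exact: ExecSeq exp exq.
Qed.

Lemma runs_frame p s T Q : runs p s T Q ->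
  runs p s T (fun s' => Q s' /\ forall x, x \notin assigned p -> vars s' x = vars s x).
Proof.
move=> [t [s' [ex let_ Qs]]]; exists t, s'; split=> //; split=> // x.
exact: exec_frame ex.
Qed.

(** With truncated subtraction, [y - x] is nonzero exactly when [x < y]. *)
Definition For x y p :=
  Seq (Assign x (Const 0))
      (While (Defs.Sub (Var y) (Var x)) (Seq p (Assign x (Add (Var x) (Const 1))))).

(** Knowledge about variables is kept as an association list, so that its preservation by a concrete
    program is settled by computation. *)
Definition has_env (env : seq (nat * nat)) s :=
  all (fun z => vars s z.1 == z.2) env.

Lemma has_envP env s x i : has_env env s -> (x, i) \in env -> vars s x = i.
Proof. by move=> /allP env_s /env_s/eqP. Qed.

Definition untouched (xs : seq nat) (env : seq (nat * nat)) :=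
  all (fun z => z.1 \notin xs) env.

Lemma has_env_untouched env s s' xs :
  untouched xs env -> (forall x, x \notin xs -> vars s' x = vars s x) ->
  has_env env s -> has_env env s'.
Proof.
move=> /allP un frame /allP env_s; apply/allP => z z_env.
by rewrite frame ?un //; apply: env_s.
Qed.

Lemma runs_env p s T Q env :
  untouched (assigned p) env -> has_env env s -> runs p s T Q ->
  runs p s T (fun s' => Q s' /\ has_env env s').
Proof.
move=> un env_s /runs_frame; apply: runs_weaken => // s' [Qs' frame].
by split=> //; exact: has_env_untouched un frame env_s.
Qed.

(** The invariant concerns the memory only; [env] takes care of the variables. Each round adds 4
    steps for the test and 4 for the increment; the last 6 are 2 for the initialisation and 4 for
    the failing test. *)
Lemma runs_for (I : nat -> (nat -> nat) -> Prop) env x y p N T s :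
  (forall i s, i < N -> has_env ((x, i) :: env) s -> I i (memory s) ->
     runs p s T (fun s' => I i.+1 (memory s'))) ->
  (y, N) \in env -> x \notin assigned p -> untouched (x :: assigned p) env ->
  has_env env s -> I 0 (memory s) ->
  runs (For x y p) s (N * (T + 8) + 6)
       (fun s' => I N (memory s') /\ has_env env s').
Proof.
move=> body yN xp un env_s I0.
have un_x : untouched [:: x] env.
  by apply: sub_all un => z; rewrite !inE negb_or => /andP[].
have un_p : untouched (assigned p) env.
  by apply: sub_all un => z; rewrite !inE negb_or => /andP[].
have upd_env a s1 : has_env env s1 ->
    has_env env (State (update (vars s1) x a) (memory s1)).
  apply: has_env_untouched un_x _ => z; rewrite inE /= /update.
  by move/negPf->.
(* The induction is on the number [k] of rounds still to come. *)
suff loop k i s1 : i + k = N -> vars s1 x = i -> has_env env s1 ->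
    I i (memory s1) ->
    runs (While (Defs.Sub (Var y) (Var x)) (Seq p (Assign x (Add (Var x) (Const 1)))))
      s1 (k * (T + 8) + 4) (fun s' => I N (memory s') /\ has_env env s').
  have -> : N * (T + 8) + 6 = 2 + (N * (T + 8) + 4) by lia.
  apply: (runs_seq (Q := fun s1 => [/\ vars s1 x = 0, has_env env s1
                                     & I 0 (memory s1)])).
    by apply: runs_assign; split=> //=; [rewrite /update eqxx | apply: upd_env].
  by move=> s1 [x0 env1 I1]; apply: (loop N 0).
elim: k i s1 => [|k IHk] i s1 def_N xi env1 Ii.
  exists 4, s1; split=> //; last by rewrite -def_N addn0.
  apply: ExecWhileFalse => /=.
  by rewrite xi (has_envP env1 yN) -def_N addn0 subnn.
have lt_iN : i < N by rewrite -def_N addnS ltnS leq_addr.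
have [|t1 [s2 [ex1 le1 [[I2 env2] frame2]]]] :=
    runs_frame (runs_env un_p env1 (body i s1 lt_iN _ Ii)).
  by rewrite /= xi eqxx.
pose s3 := State (update (vars s2) x i.+1) (memory s2).
have [||||t3 [s4 [ex3 le3 Q4]]] := IHk i.+1 s3.
- by rewrite addSnnS.
- by rewrite /= /update eqxx.
- exact: upd_env.
- by [].
exists (3 + (t1 + 4) + t3).+1, s4; split=> //; last first.
  by rewrite mulSn; move: le1 le3; lia.
apply: ExecWhileTrue ex3 => /=.
  by rewrite xi (has_envP env1 yN) subn_eq0 -ltnNge.
apply: ExecSeq ex1 _.
have -> : s3 = State (update (vars s2) x (eval s2 (Add (Var x) (Const 1)))) (memory s2).
  by rewrite /= frame2 // xi addn1.
exact: (ExecAssign s2 x (Add (Var x) (Const 1))).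
Qed.

(** * The program *)

Definition Neg a := Defs.Sub (Const 1) a.
(** Zero stands for false: [Neg] is negation, [Add] is disjunction, and [Dist], the absolute
    difference, tests for inequality. *)
Definition Dist a b := Add (Defs.Sub a b) (Defs.Sub b a).

Lemma eval_Neg s a : eval s (Neg a) = (eval s a == 0).
Proof. by rewrite /=; case: (eval s a). Qed.

Lemma eval_Neg_eq0 s a : (eval s (Neg a) == 0) = (eval s a != 0).
Proof. by rewrite eval_Neg eqb0. Qed.

Lemma eval_Neg_neq0 s a : (eval s (Neg a) != 0) = (eval s a == 0).
Proof. by rewrite eval_Neg_eq0 negbK. Qed.

Lemma eval_Dist s a b : (eval s (Dist a b) == 0) = (eval s a == eval s b).
Proof. by rewrite /=; lia. Qed.

Definition times t a := iter t (Add a) (Const 0).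

Lemma eval_times s t a : eval s (times t a) = t * eval s a.
Proof. by elim: t => //= t ->. Qed.

Definition vn := 1.
Definition vm := 2.
Definition vb := 3.
Definition v2 := 4.

(* A table in front of the cells gives the address where row [a] starts, because
   the machine cannot multiply; a row holds one line of each of five |V| x |V|
   blocks. *)
Definition address t a b :=
  Add (Add (Read (Add (Var vb) a)) (times t (Var vn))) b.

Definition cell t a b := Read (address t a b).

Definition mark c t a b := If c (Write (address t a b) (Const 1)) Skip.

(* In a 2-uniform input word the ends of edge [k] are in cells [3 + 3k] and
   [4 + 3k]; [o < 2] selects an orientation of the edge. *)
Definition source k o := Read (Add (Add (Add (Add (Const 3) k) k) k) o).
Definition target k o := Read (Defs.Sub (Add (Add (Add (Const 4) k) k) k) o).

Definition for_arcs k o p := For k vm (For o v2 p).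

(** An edge takes three cells of the input, so the table of row addresses starts at [2 + 3|E|],
    right after the word. Each entry adds [5|V|] to the previous one; with its [|V| + 1] entries the
    table ends where row 0 begins. *)
Definition prologue :=
  Seq (Assign vn (Read (Const 0)))
 (Seq (Assign vm (Read (Const 1)))
 (Seq (Assign vb (Add (Const 2) (times 3 (Var vm))))
 (Seq (Assign v2 (Const 2))
 (Seq (Write (Var vb) (Add (Add (Var vb) (Var vn)) (Const 1)))
      (For 5 vn (Write (Add (Add (Var vb) (Var 5)) (Const 1))
                       (Add (Read (Add (Var vb) (Var 5))) (times 5 (Var vn))))))))).

(* The phases fill, in this order, block 0 with the adjacency matrix, block 1
   with the relation [together], cells [(u, 0)] of block 2 with
   [closed_nbhd_apart], and cells [(0, 0)] of blocks 3 and 4 with the two ways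
   in which conformality can fail. *)
Definition mark_adjacent :=
  for_arcs 5 6 (mark (Const 1) 0 (source (Var 5) (Var 6)) (target (Var 5) (Var 6))).

Definition mark_together :=
  let a := source (Var 5) (Var 6) in let b := target (Var 5) (Var 6) in
  let c := source (Var 7) (Var 8) in let d := target (Var 7) (Var 8) in
  for_arcs 5 6 (for_arcs 7 8
    (mark (Neg (Add (Add (Neg (Dist b c)) (Neg (Dist d a))) (cell 0 b d))) 1 a c)).

(** Pairs of arcs with a common source [a] enumerate the pairs of neighbours of [a]. *)
Definition mark_apart :=
  let a := source (Var 5) (Var 6) in let b := target (Var 5) (Var 6) in
  let c := source (Var 7) (Var 8) in let d := target (Var 7) (Var 8) in
  for_arcs 5 6 (for_arcs 7 8
    (mark (Add (Neg (Add (Dist a c) (cell 1 b d))) (Neg (cell 1 a b)))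
          2 a (Const 0))).

Definition mark_missed :=
  let a := source (Var 5) (Var 6) in let b := target (Var 5) (Var 6) in
  for_arcs 5 6 (For 7 vn (For 8 vn
    (mark (Neg (Add (Add (cell 1 (Var 7) a) (cell 1 (Var 8) b))
                    (Neg (cell 1 (Var 7) (Var 8)))))
          3 (Const 0) (Const 0)))).

(** Marking in a loop expresses an existential quantifier, so the universal one over [u] is refuted
    by a vertex left unmarked in block 2. *)
Definition mark_not_apart :=
  For 5 vn (mark (Neg (cell 2 (Var 5) (Const 0))) 4 (Const 0) (Const 0)).

Definition decide_dual_conformal :=
  Seq prologue
 (Seq mark_adjacent
 (Seq mark_together
 (Seq mark_apart
 (Seq mark_missed
 (Seq mark_not_apart
      (Assign 0 (Neg (Add (cell 3 (Const 0) (Const 0))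
                          (cell 4 (Const 0) (Const 0)))))))))).

(** * Reading the input word *)

Section Correctness.

Variables (V : finType) (E : {set {set V}}).
Hypotheses (coverE : cover E = [set: V]) (uniformE : uniform 2 E).

Variables (v0 : V) (vs : seq V) (es : seq (seq V)).
Hypotheses (vs_enum : perm_eq vs (enum V)) (es_uniq : all uniq es).
Hypothesis es_E : perm_eq [seq [set v in e] | e <- es] (enum E).
(** With [v0] as the vertex numbered 0, the address [Const 0] denotes a vertex, and conditions on
    fewer than two vertices fit into the blocks with [v0] in the free coordinates. *)
Hypothesis idx_v0 : index v0 vs = 0.

Let n := size vs.
Let m := size es.
Let idx x := index x vs.
Let word := n :: m ::
  flatten [seq size e :: [seq index v vs | v <- e] | e <- es].
Let base := 2 + (m + m + m).
Let row u := base + n + 1 + u * (5 * n).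

(** The orientation [o < 2] of edge [k] has source [arc k o] and target [arc k (1 - o)]. *)
Definition arc k o := nth v0 (nth [::] es k) o.

Lemma mem_vs x : x \in vs.
Proof. by rewrite (perm_mem vs_enum) mem_enum. Qed.

Lemma idx_lt x : idx x < n.
Proof. by rewrite /idx /n index_mem mem_vs. Qed.

Lemma idx_inj : injective idx.
Proof. by move=> x y; apply: (index_inj x (mem_vs x) (mem_vs y)). Qed.

Lemma size_edge e : e \in es -> size e = 2.
Proof.
move=> e_es; have /card_uniqP <- := allP es_uniq e e_es.
have : [set v in e] \in E.
  by rewrite -mem_enum -(perm_mem es_E); apply: map_f.
by move/(forall_inP uniformE)/eqP <-; apply: eq_card => v; rewrite inE.
Qed.

(** Every edge contributes its size and two ends, that is three cells; the leading 1 skips the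
    size. *)
Lemma nth_flatten_edges (s : seq (seq V)) k o :
  (forall e, e \in s -> size e = 2) -> k < size s -> o < 2 ->
  nth 0 (flatten [seq size e :: [seq index v vs | v <- e] | e <- s])
      (1 + (k + k + k) + o) = idx (nth v0 (nth [::] s k) o).
Proof.
elim: s k => // e s IHs k sz lt_k lt_o; have sz_e := sz e (mem_head _ _).
have sz_s f : f \in s -> size f = 2 by move=> fs; rewrite sz ?inE ?fs ?orbT.
case: k lt_k => [|k] lt_k /=.
  by rewrite nth_cat size_map sz_e lt_o (nth_map v0) ?sz_e.
rewrite -(IHs k) // nth_cat size_map sz_e.
have -> : k.+1 + k.+1 + k.+1 + o < 2 = false by lia.
by congr (nth _ _ _); lia.
Qed.

Lemma nth_word k o : k < m -> o < 2 ->
  nth 0 word (3 + (k + k + k) + o) = idx (arc k o).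
Proof. by move=> lt_k lt_o; rewrite -nth_flatten_edges //; apply: size_edge. Qed.

(** Each edge is listed as two distinct vertices, and its two orientations give both ordered
    pairs. *)
Lemma exists_arcs (f : V -> V -> bool) :
  [exists k : 'I_m, [exists o : 'I_2, f (arc k o) (arc k (1 - o))]] =
  [exists x, exists y, adjacent E x y && f x y].
Proof.
apply/existsP/existsP => [[k /existsP[o fko]] | [x /existsP[y /andP[xy fxy]]]].
  exists (arc k o); apply/existsP; exists (arc k (1 - o)); rewrite fko andbT.
  have k_es : nth [::] es k \in es by rewrite mem_nth.
  rewrite /adjacent -mem_enum -(perm_mem es_E).
  suff -> : [set arc k o; arc k (1 - o)] = [set v in nth [::] es k] by apply: map_f.
  have := size_edge k_es; rewrite /arc; case: (nth _ es k) => [|a [|b []]] // _.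
  by apply/setP=> v; case: o {fko} => [[|[]]] // ?; rewrite !inE // orbC.
have : [set x; y] \in [seq [set v in e] | e <- es] by rewrite (perm_mem es_E) mem_enum.
case/mapP=> e e_es def_e.
have lt_k : index e es < m by rewrite index_mem.
exists (Ordinal lt_k) => /=; apply/existsP.
have def_k : nth [::] es (index e es) = e by rewrite nth_index.
have xy' : x != y by apply: contraTneq xy => ->; rewrite adjacent_irr.
rewrite /arc def_k; have [x_e y_e] : x \in e /\ y \in e.
  by have /setP ee := def_e; split; [have := ee x | have := ee y];
     rewrite !inE eqxx ?orbT => <-.
case: e {e_es def_e lt_k def_k} (size_edge e_es) x_e y_e => [|a [|b []]] // _.
rewrite !inE => /orP[]/eqP def_x /orP[]/eqP def_y;
  rewrite {}def_x {}def_y ?eqxx // in fxy xy'.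
  by exists ord0.
by exists (Ordinal (isT : 1 < 2)).
Qed.

Lemma exists_vertices (P : pred V) :
  [exists i : 'I_n, P (nth v0 vs i)] = [exists x, P x].
Proof.
apply/existsP/existsP => [[i Pi] | [x Px]]; first by exists (nth v0 vs i).
by exists (Ordinal (idx_lt x)); rewrite /= /idx nth_index ?mem_vs.
Qed.

(** * Memory layout and marking loops *)

Implicit Types (F : nat -> V -> V -> bool) (P Q : V -> V -> bool).
Implicit Types (mem : nat -> nat).

Definition layout F mem :=
  [/\ forall k o, k < m -> o < 2 -> mem (3 + (k + k + k) + o) = idx (arc k o),
      forall u, u < n -> mem (base + u) = row u
    & forall t x y, t < 5 -> mem (row (idx x) + t * n + idx y) = F t x y].

Definition add_block F t Q : nat -> V -> V -> bool :=
  fun t' x y => F t' x y || (t' == t) && Q x y.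

Lemma layout_ext F F' mem :
  (forall t x y, F t x y = F' t x y) -> layout F mem -> layout F' mem.
Proof. by move=> eqF [L1 L2 L3]; split=> // t x y /L3->; rewrite eqF. Qed.

(** Up to a constant, the address is a mixed-radix number with digits [idx x], [t < 5] and
    [idx y < n], which division by [n] and then by 5 recovers. *)
Lemma cell_inj t t' x x' y y' : t < 5 -> t' < 5 ->
  row (idx x) + t * n + idx y = row (idx x') + t' * n + idx y' ->
  [/\ t = t', x = x' & y = y'].
Proof.
move=> lt_t lt_t' eq_cell; have n_gt0 : 0 < n by apply: leq_trans (idx_lt x).
have eq1 : (idx x * 5 + t) * n + idx y = (idx x' * 5 + t') * n + idx y'.
  by move: eq_cell; rewrite /row !mulnDl -!mulnA; lia.
have eq_y : idx y = idx y'.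
  by move/(congr1 (modn^~ n)): eq1; rewrite !modnMDl !modn_small ?idx_lt.
have eq_q : idx x * 5 + t = idx x' * 5 + t'.
  by move/(congr1 (divn^~ n)): eq1; rewrite !divnMDl // !divn_small ?idx_lt // !addn0.
have eq_t : t = t'.
  by move/(congr1 (modn^~ 5)): eq_q; rewrite !modnMDl !modn_small.
have eq_x : idx x = idx x' by lia.
by split=> //; apply: idx_inj.
Qed.

Lemma layout_write F mem t x y : t < 5 -> layout F mem ->
  layout (add_block F t (fun u v => (u == x) && (v == y)))
         (update mem (row (idx x) + t * n + idx y) 1).
Proof.
move=> lt_t [L1 L2 L3]; split=> [k o lt_k lt_o | u lt_u | t' u v lt_t'].
- by rewrite /update ifN ?L1 //; apply/eqP; rewrite /row /base; lia.
- by rewrite /update ifN ?L2 //; apply/eqP; rewrite /row; lia.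
rewrite /update /add_block; have [/cell_inj[] // -> -> -> | ne] := eqVneq.
  by rewrite !eqxx orbT.
rewrite L3 //; case: eqP => [def_t|]; last by rewrite orbF.
case: eqP => [def_u|]; last by rewrite orbF.
case: eqP => [def_v|]; last by rewrite orbF.
by rewrite def_t def_u def_v eqxx in ne.
Qed.

(** Marks are never erased, so a program is described by the relation [P] that it adds to the
    arbitrary earlier content [Q] of block [t]. In this form loops turn into existential
    quantifiers. *)
Definition marks env F t P T p := forall Q s, has_env env s ->
  layout (add_block F t Q) (memory s) ->
  runs p s T (fun s' =>
    layout (add_block F t (fun x y => Q x y || P x y)) (memory s')).

Lemma marks_ext env F t P P' T p :
  P =2 P' -> marks env F t P T p -> marks env F t P' T p.
Proof.
move=> eqP mk Q s env_s L; apply: runs_weaken (mk Q s env_s L) => // s'.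
by apply: layout_ext => t' x y; rewrite /add_block eqP.
Qed.

Lemma marks_for env F t (P : nat -> V -> V -> bool) T p x y N :
  (forall i, i < N -> marks ((x, i) :: env) F t (P i) T p) ->
  (y, N) \in env -> x \notin assigned p -> untouched (x :: assigned p) env ->
  marks env F t (fun u v => [exists i : 'I_N, P i u v]) (N * (T + 8) + 6)
        (For x y p).
Proof.
move=> body yN xp un Q s env_s L.
(* The block before round [i]: the old content and the marks of the earlier rounds. *)
pose R i := add_block F t (fun u v => Q u v || [exists j : 'I_N, (j < i) && P j u v]).
have /(_ _ _)/runs_weaken := @runs_for (fun i => layout (R i)) env x y p N T s _ yN xp un env_s.
apply=> //.
- move=> s' [L' _]; apply: layout_ext L' => t' u v; rewrite /R /add_block.
  by congr (_ || _ && (_ || _)); apply: eq_existsb => j; rewrite ltn_ord.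
- move=> i s1 lt_i env1 L1; apply: runs_weaken (body i lt_i _ s1 env1 L1) => // s2.
  apply: layout_ext => t' u v; rewrite /R /add_block -orbA.
  congr (_ || _ && (_ || _)); apply/orP/existsP => [[/existsP[j /andP[lt_j Pj]]|Pi]|].
  - by exists j; rewrite ltnS ltnW.
  - by exists (Ordinal lt_i); rewrite /= ltnSn.
  case=> j /andP[]; rewrite ltnS leq_eqVlt => /orP[/eqP <-|lt_j] Pj; [by right | left].
  by apply/existsP; exists j; rewrite lt_j.
apply: layout_ext L => t' u v; rewrite /R /add_block; congr (_ || _ && _).
by rewrite (_ : [exists j, _] = false) ?orbF //; apply/existsP=> -[].
Qed.

Lemma marks_vertices env F t (P : V -> V -> V -> bool) T p x :
  (forall z, marks ((x, idx z) :: env) F t (P z) T p) ->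
  (vn, n) \in env -> x \notin assigned p -> untouched (x :: assigned p) env ->
  marks env F t (fun u v => [exists z, P z u v]) (n * (T + 8) + 6) (For x vn p).
Proof.
move=> body nN xp un.
apply: (marks_ext (P := fun u v => [exists i : 'I_n, P (nth v0 vs i) u v])).
  by move=> u v; apply: (exists_vertices (fun z => P z u v)).
apply: (marks_for (P := fun i => P (nth v0 vs i))) => // i lt_i.
have := body (nth v0 vs i); rewrite /idx index_uniq //.
by rewrite (perm_uniq vs_enum) enum_uniq.
Qed.

Lemma marks_arcs env F t (P : V -> V -> V -> V -> bool) T p k o :
  (forall i j, i < m -> j < 2 ->
     marks ((o, j) :: (k, i) :: env) F t (P (arc i j) (arc i (1 - j))) T p) ->
  (vm, m) \in env -> (v2, 2) \in env ->
  k != o -> k \notin assigned p -> o \notin assigned p ->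
  untouched [:: k, o & assigned p] env ->
  marks env F t
    (fun u v => [exists x, exists y, adjacent E x y && P x y u v])
    (m * (2 * (T + 8) + 6 + 8) + 6) (for_arcs k o p).
Proof.
move=> body mN twoN ko kp op un.
apply: (marks_ext (P := fun u v =>
    [exists i : 'I_m, [exists j : 'I_2, P (arc i j) (arc i (1 - j)) u v]])).
  by move=> u v; apply: (exists_arcs (fun x y => P x y u v)).
(* The counter is assigned both before the body and after it, so the lists agree only up to
   order. *)
have asg q : assigned (For o v2 q) =i o :: o :: assigned q.
  by move=> z; rewrite /= !(inE, mem_cat); case: (z == o); rewrite ?orbF.
have sub_un a b : {subset a <= b} -> untouched b env -> untouched a env.
  by move=> ab un_b; apply: sub_all un_b => z; apply: contra => /ab.
apply: (marks_for (P := fun i u v =>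
    [exists j : 'I_2, P (arc i j) (arc i (1 - j)) u v])) => // [i lt_i||].
- apply: (marks_for (P := fun j => P (arc i j) (arc i (1 - j)))) => //.
  + by move=> j lt_j; apply: body.
  + by rewrite inE twoN orbT.
  + rewrite /untouched /= inE negb_or ko kp /=.
    by apply: sub_un un => z; rewrite !inE => ->; rewrite orbT.
- by rewrite asg !inE !negb_or ko kp.
- apply: sub_un un => z; rewrite inE asg !inE.
  by case: (z == k) => //; case: (z == o).
Qed.

(** The test must have value [b] for every partial content [Q] of block [t]; tests that read only
    the input and other blocks meet this. *)
Lemma marks_mark env F t x y b c eu ev T : t < 5 ->
  cost c + cost (address t eu ev) + 3 <= T ->
  (vn, n) \in env -> (vb, base) \in env ->
  (forall Q s, has_env env s -> layout (add_block F t Q) (memory s) ->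
     [/\ (eval s c != 0) = b, eval s eu = idx x & eval s ev = idx y]) ->
  marks env F t (fun u v => [&& b, u == x & v == y])
        T (mark c t eu ev).
Proof.
move=> lt_t le_T nN bN evs Q s env_s L; have [def_b def_x def_y] := evs Q s env_s L.
have [_ L2 _] := L.
have [bT|bF] := boolP b.
  do 2!eexists; split; first by apply: ExecIfTrue; [rewrite def_b bT | apply: ExecWrite].
    by apply: leq_trans le_T; move: (cost c) (cost _) => ? ? /=; lia.
  rewrite /= eval_times /= def_x def_y (has_envP env_s nN) (has_envP env_s bN).
  rewrite L2 ?idx_lt //.
  apply: layout_ext (layout_write x y lt_t L) => t' u v.
  by rewrite /add_block -orbA -andb_orr.
exists (cost c + 1).+1, s; split; last 1 first.
- by apply: layout_ext L => t' u v; rewrite /add_block /= orbF.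
- by apply: ExecIfFalse; [apply/eqP; rewrite -[_ == _]negbK def_b | apply: ExecSkip].
by apply: leq_trans le_T; move: (cost c) (cost _) => ? ? /=; lia.
Qed.

Lemma eval_cell F s t a b x y : t < 5 -> layout F (memory s) ->
  vars s vn = n -> vars s vb = base -> eval s a = idx x -> eval s b = idx y ->
  eval s (cell t a b) = F t x y.
Proof.
move=> lt_t [_ L2 L3] nN bN ax bY.
by rewrite /= eval_times /= ax bY nN bN L2 ?idx_lt ?L3.
Qed.

Lemma eval_source F s k o i j : layout F (memory s) ->
  vars s k = i -> vars s o = j -> i < m -> j < 2 ->
  eval s (source (Var k) (Var o)) = idx (arc i j).
Proof.
move=> [L1 _ _] ki oj lt_i lt_j; rewrite -L1 //=.
by rewrite ki oj; congr (memory s _); lia.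
Qed.

Lemma eval_target F s k o i j : layout F (memory s) ->
  vars s k = i -> vars s o = j -> i < m -> j < 2 ->
  eval s (target (Var k) (Var o)) = idx (arc i (1 - j)).
Proof.
move=> [L1 _ _] ki oj lt_i lt_j; rewrite -L1 //=; last by lia.
by rewrite ki oj; congr (memory s _); lia.
Qed.

(** * Correctness and cost of the phases *)

Definition block t u v :=
  match t with
  | 0 => adjacent E u v
  | 1 => together E u v
  | 2 => closed_nbhd_apart E u && (v == v0)
  | 3 => [&& missed_edge E, u == v0 & v == v0]
  | _ => [&& ~~ [forall x, closed_nbhd_apart E x], u == v0 & v == v0]
  end.

(** The content before phase [k]: earlier blocks are complete and may be read, the others are still
    empty. *)
Definition stage k t u v := (t < k) && block t u v.

Lemma add_block_stage k t Q u v :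
  t < k -> add_block (stage k) k Q t u v = block t u v.
Proof. by move=> lt_t; rewrite /add_block /stage lt_t ltn_eqF // orbF. Qed.

Definition globals := [:: (vn, n); (vm, m); (vb, base); (v2, 2)].

Lemma runs_phase k T p s :
  marks globals (stage k) k (block k) T p ->
  untouched (assigned p) globals ->
  layout (stage k) (memory s) /\ has_env globals s ->
  runs p s T (fun s' => layout (stage k.+1) (memory s') /\ has_env globals s').
Proof.
move=> mk un [L env_s]; apply: runs_env => //.
have [|t [s' [ex le_t L']]] := mk (fun _ _ => false) s env_s.
  by apply: layout_ext L => t x y; rewrite /add_block andbF orbF.
exists t, s'; split=> //; apply: layout_ext L' => t' x y.
rewrite /add_block /stage ltnS [t' <= k]leq_eqVlt.
by case: eqVneq => [->|_]; rewrite ?ltnn ?orbF.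
Qed.

Lemma idx0 s : eval s (Const 0) = idx v0. Proof. by rewrite /idx idx_v0. Qed.

Lemma eval_Add s a b : eval s (Add a b) = eval s a + eval s b.
Proof. by []. Qed.

Lemma eval_cell_block k Q s t a b x y : t < k -> k < 5 ->
  vars s vn = n -> vars s vb = base ->
  layout (add_block (stage k) k Q) (memory s) ->
  eval s a = idx x -> eval s b = idx y ->
  eval s (cell t a b) = block t x y.
Proof.
move=> lt_t lt_k nN bN L ax bY.
rewrite (eval_cell (F := add_block (stage k) k Q) (x := x) (y := y)) //.
  by rewrite add_block_stage.
exact: ltn_trans lt_k.
Qed.

Lemma neqb0 (b : bool) : (b != 0 :> nat) = b.
Proof. by case: b. Qed.

Definition testE :=
  (eval_Neg_neq0, eval_Neg_eq0, eval_Add, addn_eq0, negb_and, eval_Dist).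

Ltac in_env := by rewrite !inE !eqxx ?orbT.
Ltac lookup env_s := apply: (has_envP env_s); in_env.

(** Here and in the later phases, 200 is a generous bound on the cost of one [mark], checked by
    computation. *)
Lemma runs_mark_adjacent s :
  layout (stage 0) (memory s) /\ has_env globals s ->
  runs mark_adjacent s (m * (2 * (200 + 8) + 6 + 8) + 6)
    (fun s' => layout (stage 1) (memory s') /\ has_env globals s').
Proof.
apply: runs_phase => //.
apply: (marks_ext (P := fun u v => [exists x, exists y,
          adjacent E x y && [&& true, u == x & v == y]])).
  move=> u v /=; apply/existsP/idP => [[x /existsP[y]] | uv].
    by case/and3P=> xy /eqP-> /eqP->.
  by exists u; apply/existsP; exists v; rewrite uv !eqxx.
apply: (marks_arcs (P := fun x y u v => [&& true, u == x & v == y])) => //; try in_env.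
move=> i j lt_i lt_j; apply: marks_mark => [//|//|||Q s1 env_s L]; [in_env | in_env | ].
split=> //; [apply: eval_source L _ _ lt_i lt_j | apply: eval_target L _ _ lt_i lt_j];
  lookup env_s.
Qed.

Lemma runs_mark_together s :
  layout (stage 1) (memory s) /\ has_env globals s ->
  runs mark_together s
    (m * (2 * (m * (2 * (200 + 8) + 6 + 8) + 6 + 8) + 6 + 8) + 6)
    (fun s' => layout (stage 2) (memory s') /\ has_env globals s').
Proof.
apply: runs_phase => //.
(* The arcs run from [x] to [y] and from [x'] to [y']: the pair to be marked is [x], [x'], and [y],
   [y'] are the witnesses. *)
pose P x y x' y' u v :=
  [&& [&& y != x', y' != x & ~~ adjacent E y y'], u == x & v == x'].
apply: (marks_ext (P := fun u v => [exists x, exists y, adjacent E x y &&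
          [exists x', exists y', adjacent E x' y' && P x y x' y' u v]])).
  move=> u v; apply/existsP/existsP => [[x /existsP[y /andP[xy]]] | [y /existsP[y']]].
    case/existsP=> x' /existsP[y' /andP[xy' /and3P[/and3P[? ? ?] /eqP-> /eqP->]]].
    by exists y; apply/existsP; exists y'; apply/and5P.
  case/and5P=> uy vy' yv y'u yy'; exists u; apply/existsP; exists y; rewrite uy /=.
  by apply/existsP; exists v; apply/existsP; exists y'; rewrite /P vy' yv y'u yy' !eqxx.
apply: (marks_arcs (P := fun x y u v =>
          [exists x', exists y', adjacent E x' y' && P x y x' y' u v])) => //; try in_env.
move=> i j lt_i lt_j; apply: (marks_arcs (P := P (arc i j) (arc i (1 - j)))) => //; try in_env.
move=> i' j' lt_i' lt_j'; apply: marks_mark => [//|//|||Q s1 env_s L]; [in_env | in_env | ].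
have nN : vars s1 vn = n by lookup env_s.
have bN : vars s1 vb = base by lookup env_s.
have ea : eval s1 (source (Var 5) (Var 6)) = idx (arc i j).
  by apply: eval_source L _ _ lt_i lt_j; lookup env_s.
have eb : eval s1 (target (Var 5) (Var 6)) = idx (arc i (1 - j)).
  by apply: eval_target L _ _ lt_i lt_j; lookup env_s.
have ec : eval s1 (source (Var 7) (Var 8)) = idx (arc i' j').
  by apply: eval_source L _ _ lt_i' lt_j'; lookup env_s.
have ed : eval s1 (target (Var 7) (Var 8)) = idx (arc i' (1 - j')).
  by apply: eval_target L _ _ lt_i' lt_j'; lookup env_s.
split=> //; rewrite !testE (eval_cell_block _ _ nN bN L eb ed) //.
by rewrite ea eb ec ed !(inj_eq idx_inj) eqb0 -andbA.
Qed.

Lemma runs_mark_apart s :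
  layout (stage 2) (memory s) /\ has_env globals s ->
  runs mark_apart s
    (m * (2 * (m * (2 * (200 + 8) + 6 + 8) + 6 + 8) + 6 + 8) + 6)
    (fun s' => layout (stage 3) (memory s') /\ has_env globals s').
Proof.
apply: runs_phase => //.
pose P x y x' y' u v :=
  [&& (x == x') && ~~ together E y y' || ~~ together E x y, u == x & v == v0].
apply: (marks_ext (P := fun u v => [exists x, exists y, adjacent E x y &&
          [exists x', exists y', adjacent E x' y' && P x y x' y' u v]])).
  move=> u v; apply/existsP/andP => [[x /existsP[y /andP[xy]]] | [/existsP[x /existsP[y]]]].
    case/existsP=> x' /existsP[y' /andP[xy' /and3P[apart /eqP-> ->]]]; split=> //.
    apply/existsP; exists y; apply/existsP; exists y'; rewrite xy /=.
    by case/orP: apart xy' => [/andP[/eqP<- ->] ->|->]; rewrite ?orbT.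
  move=> apart vv0; have ux : adjacent E u x by case/orP: apart => [/and3P[]|/andP[]].
  exists u; apply/existsP; exists x; rewrite ux /=; apply/existsP; exists u.
  apply/existsP; case/orP: apart => [/and3P[_ uy xy]|/andP[_ nux]].
    by exists y; rewrite /P uy xy !eqxx vv0.
  (* Any second arc would do here; the first one is taken again. *)
  by exists x; rewrite /P ux nux orbT eqxx vv0.
apply: (marks_arcs (P := fun x y u v =>
          [exists x', exists y', adjacent E x' y' && P x y x' y' u v])) => //; try in_env.
move=> i j lt_i lt_j; apply: (marks_arcs (P := P (arc i j) (arc i (1 - j)))) => //; try in_env.
move=> i' j' lt_i' lt_j'; apply: marks_mark => [//|//|||Q s1 env_s L]; [in_env | in_env | ].
have nN : vars s1 vn = n by lookup env_s.
have bN : vars s1 vb = base by lookup env_s.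
have ea : eval s1 (source (Var 5) (Var 6)) = idx (arc i j).
  by apply: eval_source L _ _ lt_i lt_j; lookup env_s.
have eb : eval s1 (target (Var 5) (Var 6)) = idx (arc i (1 - j)).
  by apply: eval_target L _ _ lt_i lt_j; lookup env_s.
have ec : eval s1 (source (Var 7) (Var 8)) = idx (arc i' j').
  by apply: eval_source L _ _ lt_i' lt_j'; lookup env_s.
have ed : eval s1 (target (Var 7) (Var 8)) = idx (arc i' (1 - j')).
  by apply: eval_target L _ _ lt_i' lt_j'; lookup env_s.
split; [|exact: ea|exact: idx0].
rewrite !testE (eval_cell_block _ _ nN bN L eb ed) //.
rewrite (eval_cell_block _ _ nN bN L ea eb) //.
by rewrite ea ec !(inj_eq idx_inj) !eqb0.
Qed.

Lemma runs_mark_missed s :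
  layout (stage 3) (memory s) /\ has_env globals s ->
  runs mark_missed s
    (m * (2 * (n * (n * (200 + 8) + 6 + 8) + 6 + 8) + 6 + 8) + 6)
    (fun s' => layout (stage 4) (memory s') /\ has_env globals s').
Proof.
apply: runs_phase => //.
pose P x y x' y' u v :=
  [&& [&& ~~ together E x' x, ~~ together E y' y & together E x' y'],
      u == v0 & v == v0].
apply: (marks_ext (P := fun u v => [exists x, exists y, adjacent E x y &&
          [exists x', exists y', P x y x' y' u v]])).
  move=> u v; apply/existsP/andP => [[x /existsP[y /andP[xy]]] | [/existsP[x /existsP[y]]]].
    case/existsP=> x' /existsP[y' /and3P[mis -> ->]]; split=> //.
    apply/existsP; exists x; apply/existsP; exists y; rewrite xy.
    by apply/existsP; exists x'; apply/existsP; exists y'.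
  case/andP=> xy /existsP[x' /existsP[y' mis]] uv.
  exists x; apply/existsP; exists y; rewrite xy.
  by apply/existsP; exists x'; apply/existsP; exists y'; apply/andP.
apply: (marks_arcs (P := fun x y u v =>
          [exists x', exists y', P x y x' y' u v])) => //; try in_env.
move=> i j lt_i lt_j; apply: (marks_vertices (P := fun x' u v =>
          [exists y', P (arc i j) (arc i (1 - j)) x' y' u v])) => //; try in_env.
move=> x'; apply: (marks_vertices (P := P (arc i j) (arc i (1 - j)) x')) => //; try in_env.
move=> y'; apply: marks_mark => [//|//|||Q s1 env_s L]; [in_env | in_env | ].
have nN : vars s1 vn = n by lookup env_s.
have bN : vars s1 vb = base by lookup env_s.
have ea : eval s1 (source (Var 5) (Var 6)) = idx (arc i j).
  by apply: eval_source L _ _ lt_i lt_j; lookup env_s.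
have eb : eval s1 (target (Var 5) (Var 6)) = idx (arc i (1 - j)).
  by apply: eval_target L _ _ lt_i lt_j; lookup env_s.
have ec : eval s1 (Var 7) = idx x' by lookup env_s.
have ed : eval s1 (Var 8) = idx y' by lookup env_s.
split; [|exact: idx0|exact: idx0].
rewrite !testE (eval_cell_block _ _ nN bN L ec ea) //.
rewrite (eval_cell_block _ _ nN bN L ed eb) //.
rewrite (eval_cell_block _ _ nN bN L ec ed) //.
by rewrite neqb0 !eqb0 -andbA.
Qed.

Lemma runs_mark_not_apart s :
  layout (stage 4) (memory s) /\ has_env globals s ->
  runs mark_not_apart s (n * (200 + 8) + 6)
    (fun s' => layout (stage 5) (memory s') /\ has_env globals s').
Proof.
apply: runs_phase => //.
pose P x u v := [&& ~~ closed_nbhd_apart E x, u == v0 & v == v0].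
apply: (marks_ext (P := fun u v => [exists x, P x u v])).
  move=> u v /=; rewrite negb_forall.
  apply/existsP/andP => [[x /andP[ap uv]] | [/existsP[x ap] uv]].
    by split=> //; apply/existsP; exists x.
  by exists x; apply/andP.
apply: (marks_vertices (P := P)) => // [x|]; last by in_env.
apply: marks_mark => [//|//|||Q s1 env_s L]; [in_env | in_env | ].
have nN : vars s1 vn = n by lookup env_s.
have bN : vars s1 vb = base by lookup env_s.
have ea : eval s1 (Var 5) = idx x by lookup env_s.
split; [|exact: idx0|exact: idx0].
by rewrite !testE (eval_cell_block _ _ nN bN L ea (idx0 _)) // eqb0 /block eqxx andbT.
Qed.

Lemma runs_prologue :
  runs prologue (initial_state word) (n * 50 + 50)
    (fun s' => layout (stage 0) (memory s') /\ has_env globals s').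
Proof.
(* Hence the table does not overlap the word, and all cells from [base] on are initially the default
   0 of [nth]. *)
have szw : size word = base.
  rewrite /base /m /=; congr _.+2.
  have := size_edge; elim: (es) => //= e s IHs sz.
  rewrite size_cat size_map IHs => [|f fs]; last by rewrite sz ?inE ?fs ?orbT.
  by rewrite sz ?mem_head //; lia.
(* The rows start just after the last table entry [base + n], so the zeros of the third clause are
   the empty blocks of [stage 0]. *)
pose filled i mem :=
  [/\ forall j, j < base -> mem j = nth 0 word j,
      forall j, j <= i -> mem (base + j) = row j
    & forall j, base + i < j -> mem j = 0].
(* The exact time bound stays open until the sequence of commands determines it; the comparison is
   made last. *)
refine (runs_weaken (Q := fun s' => filled n (memory s') /\ has_env globals s')
                    _ _ _); last first.
- apply: (runs_seq (Q := fun s => vars s vn = n /\ memory s = nth 0 word)).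
    by apply: runs_assign.
  move=> s1 [n1 w1].
  apply: (runs_seq (Q := fun s => [/\ vars s vn = n, vars s vm = m
                                    & memory s = nth 0 word])).
    by apply: runs_assign; rewrite /= w1.
  move=> s2 [n2 m2 w2].
  apply: (runs_seq (Q := fun s => [/\ vars s vn = n, vars s vm = m,
                             vars s vb = base & memory s = nth 0 word])).
    by apply: runs_assign; split=> //=; rewrite /update /= m2 /base; lia.
  move=> s3 [n3 m3 b3 w3].
  apply: (runs_seq (Q := fun s => has_env globals s /\ memory s = nth 0 word)).
    by apply: runs_assign; rewrite /= /update /= n3 m3 b3 !eqxx.
  move=> s4 [env4 w4].
  apply: (runs_seq (Q := fun s => filled 0 (memory s) /\ has_env globals s)).
    apply: runs_write; split=> //=.
    have /and4P[/eqP-> _ /eqP-> _] := env4.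
    rewrite w4; split=> j; rewrite /update; first by move=> lt_j; rewrite ltn_eqF.
      by rewrite leqn0 => /eqP->; rewrite addn0 eqxx /row mul0n addn0.
    by rewrite addn0 => lt_j; rewrite gtn_eqF // nth_default // szw ltnW.
  move=> s5 [fill5 env5].
  apply: (runs_for (I := filled) (env := globals)) => //; last by in_env.
  move=> i s lt_i env_s [F1 F2 F3]; apply: runs_write.
  rewrite /=; have /and5P[/eqP/= -> /eqP/= -> _ /eqP/= -> _] := env_s.
  rewrite F2 ?[i <= i]leqnn //; split=> j; rewrite /update.
  - by move=> lt_j; rewrite ltn_eqF ?F1 //; lia.
  - rewrite leq_eqVlt => /orP[/eqP->|]; first by rewrite addnS -addn1 eqxx /row; lia.
    by move=> lt_j; rewrite ltn_eqF ?F2 //; lia.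
  by move=> lt_j; rewrite gtn_eqF ?F3 //; lia.
- move=> s' [[F1 F2 F3] env_s]; split=> //.
  split=> [k o lt_k lt_o | u lt_u | t x y lt_t].
  + by rewrite F1 ?nth_word // /base; lia.
  + by rewrite F2 // ltnW.
  by rewrite /stage F3 // /row; lia.
by rewrite /=; lia.
Qed.

(** Each of the two phases over pairs of edges contributes [860 * m ^ 2], and the search for a
    missed edge [416 * (m * n ^ 2)]; the coefficients are rounded up. *)
Lemma runs_decide :
  runs decide_dual_conformal (initial_state word)
    (500 * (m * n ^ 2) + 50 * (m * n) + 2000 * m ^ 2 + 700 * m + 300 * n + 300)
    (fun s => output s = conformal (dual E)).
Proof.
refine (runs_weaken (Q := fun s => output s = conformal (dual E)) _
                    (fun _ out => out) _); last first.
  apply: (runs_seq runs_prologue) => s0 /runs_mark_adjacent R0.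
  apply: (runs_seq R0) => s1 /runs_mark_together R1.
  apply: (runs_seq R1) => s2 /runs_mark_apart R2.
  apply: (runs_seq R2) => s3 /runs_mark_missed R3.
  apply: (runs_seq R3) => s4 /runs_mark_not_apart R4.
  apply: (runs_seq R4) => s [L env_s].
  have nN : vars s vn = n by lookup env_s.
  have bN : vars s vb = base by lookup env_s.
  have cell_v0 t : t < 5 -> eval s (cell t (Const 0) (Const 0)) = block t v0 v0.
    by move=> lt_t; rewrite (eval_cell lt_t L nN bN (idx0 s) (idx0 s)) /stage lt_t.
  apply: runs_assign; set a := Neg _; rewrite -[output _]/(eval s a) {}/a.
  rewrite eval_Neg eval_Add addn_eq0 !cell_v0 // !eqb0 /block !eqxx !andbT.
  by rewrite negbK -conformal_dualE.
rewrite /= !expnS expn0; lia.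
Qed.

End Correctness.

Theorem theorem5p8 :
  exists (p : prog) (c : nat),
    forall (V : finType) (E : {set {set V}}) (w : seq nat),
      is_hypergraph E -> uniform 2 E -> encodes E w ->
      exists (t : nat) (s : state),
        [/\ exec p (initial_state w) t s,
            t <= c * (#|E| * #|V| ^ 2 * max_degree E ^ 2)
          & output s = nat_of_bool (conformal (dual E))].
Proof.
(* The coefficients in [runs_decide] add up to 3850, and each of its monomials, including 1, is at
   most the product [q] below. *)
exists decide_dual_conformal, 4000 => V E w /andP[V_gt0 /eqP coverE] uniformE.
case=> vs [es [vs_enum es_uniq es_E ->]].
have size_vs : size vs = #|V| by rewrite (perm_size vs_enum) -cardE.
have size_es : size es = #|E| by rewrite -(size_map (fun e => [set v in e])) (perm_size es_E) -cardE.
have [v0 idx_v0] : exists v0, index v0 vs = 0.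
  by case: (vs) size_vs V_gt0 => [<- // | v vs' _ _]; exists v; rewrite /= eqxx.
have [t [s [ex le_t out]]] :=
  runs_decide coverE uniformE vs_enum es_uniq es_E idx_v0.
exists t, s; split=> //; apply: leq_trans le_t _; rewrite size_vs size_es.
have E_gt0 : 0 < #|E|.
  have [y] := neighbour coverE uniformE v0.
  by rewrite /adjacent => vy; apply/card_gt0P; exists [set v0; y].
have := card_edges uniformE; move: (max_degree E) => d le_Ed.
have d_gt0 : 0 < d by move: le_Ed; rewrite lt0n; case: eqP => [->|//]; lia.
move: #|E| #|V| E_gt0 V_gt0 le_Ed => m n m_gt0 n_gt0 le_md.
set q := m * n ^ 2 * d ^ 2.
have q_mnn : m * n ^ 2 <= q by rewrite leq_pmulr // expn_gt0 d_gt0.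
have q_mn : m * n <= q by apply: leq_trans q_mnn; rewrite leq_mul2l leq_pmulr ?orbT.
have q_m : m <= q by apply: leq_trans q_mn; rewrite leq_pmulr.
have q_n : n <= q by apply: leq_trans q_mn; rewrite leq_pmull.
(* One factor [m] is replaced by [n * d] through [card_edges]. *)
have q_mm : m ^ 2 <= q.
  rewrite /q -mulnA leq_mul2l; apply/orP; right; apply: leq_trans le_md _.
  by rewrite leq_mul // leq_pmulr.
lia.
Qed.
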